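(* Let $(\xi_n)_{n\ge1}$ be a sequence of independent random variables taking the values $0$ and $1$ with probabilities $p_{0n}\ge 0$ and $p_{1n}\ge 0$, respectively ($p_{0n}+p_{1n}=1$), and let $\xi=\Delta^{G_2}_{\xi_1\xi_2\ldots\xi_n\ldots}$. Suppose that $M=\prod_{n=1}^\infty\max\{p_{0n},p_{1n}\}=0$ (the case of a continuous distribution). Then $\xi$ has either a pure absolutely continuous or a pure singular distribution (with respect to Lebesgue measure). Moreover, it is absolutely continuous if and only if $$S=\sum_{n=1}^\infty\left[\left(1-\frac{p_{0n}}{g_0}\right)^2+\left(1+\frac{p_{1n}}{g_1}\right)^2\right]<\infty.$$
   Context: Fix a real number $g_0\in[\frac12,1)$ and put $g_1=g_0-1$ (so $g_1<0$), $\delta_0=0$, $\delta_1=g_0$. For a sequence $(\alpha_n)_{n\ge1}$ of elements of $\{0,1\}$ put $$\Delta^{G_2}_{\alpha_1\alpha_2\ldots\alpha_n\ldots}=\delta_{\alpha_1}+\sum_{k=2}^\infty \delta_{\alpha_k}\prod_{j=1}^{k-1}g_{\alpha_j}\in[0,g_0].$$ Every $x\in[0,g_0]$ equals $\Delta^{G_2}_{\alpha_1\alpha_2\ldots}$ for some sequence of zeros and ones. A distribution is pure singular if it is concentrated on a set of zero Lebesgue measure (here it has no atoms). *)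

(* Defs.v *)
From HB Require Import structures.
From mathcomp Require Import all_boot all_order all_algebra finmap.
From mathcomp Require Import all_classical all_reals all_analysis.
From mathcomp Require Import measurable_realfun.

Set Implicit Arguments.
Unset Strict Implicit.
Unset Printing Implicit Defensive.

Import Order.TTheory GRing.Theory Num.Theory.
Import numFieldNormedType.Exports.

Local Open Scope classical_set_scope.
Local Open Scope ring_scope.

(* The digits 0 and 1 are [false] and [true], and digit sequences are indexed
   from 0 instead of 1. *)

Definition G2_g (R : realType) (g0 : R) (b : bool) : R :=
  if b then g0 - 1 else g0.

Definition G2_delta (R : realType) (g0 : R) (b : bool) : R :=
  if b then g0 else 0.

Definition G2_term (R : realType) (g0 : R) (a : nat -> bool) (k : nat) : R :=
  G2_delta g0 (a k) * \prod_(j < k) G2_g g0 (a j).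

Definition G2 (R : realType) (g0 : R) (a : nat -> bool) : R :=
  limn (series (G2_term g0 a)).

Lemma is_cvg_series_G2_term (R : realType) (g0 : R) (a : nat -> bool) :
  2^-1 <= g0 < 1 -> cvgn (series (G2_term g0 a)).
Proof.
move=> /andP[g0_ge g0_lt1].
have g0_gt0 : 0 < g0 by rewrite (lt_le_trans _ g0_ge)// invr_gt0.
have g0_norm : `|g0| = g0 by rewrite gtr0_norm.
have normg b : `|G2_g g0 b| <= g0.
  case: b; rewrite /= ?g0_norm// ltr0_norm ?subr_lt0// opprB lerBlDr.
  by rewrite [leLHS](splitr 1) div1r lerD.
apply: normed_cvg; apply: (series_le_cvg _ _ _ (is_cvg_geometric_series _)).
- by move=> n; exact: normr_ge0.
- by move=> n; rewrite /geometric /=; exact: (mulr_ge0 ler01 (exprn_ge0 n (ltW g0_gt0))).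
- move=> n; rewrite /geometric /= /G2_term normrM ler_pM//.
    by case: (a n); rewrite /= ?g0_norm ?normr0// ltW.
  rewrite normr_prod -[leRHS](_ : \prod_(j < n) g0 = _).
    by apply: ler_prod => i _; rewrite normr_ge0 normg.
  by rewrite prodr_const card_ord.
- by rewrite g0_norm.
Qed.

Section G2_random_variable.
Context (R : realType) (g0 : R) (d : measure_display) (T : measurableType d)
  (P : probability T R) (X : nat -> {RV P >-> bool})
  (g0_bounds : 2^-1 <= g0 < 1).

Lemma measurable_G2 : measurable_fun [set: T] (fun t => G2 g0 (X ^~ t)).
Proof.
have mdigit (f : bool -> R) n : measurable_fun [set: T] (fun t => f (X n t)).
  by apply: (measurableT_comp (f := f)) => // _ Y _.
apply: (@measurable_fun_cvg _ _ _ _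
  (fun n t => series (G2_term g0 (X ^~ t)) n)).
- move=> n; apply: measurable_sum => k; apply: measurable_funM => //.
  by apply: measurable_prod => j _; exact: mdigit.
- by move=> t _; exact: is_cvg_series_G2_term.
Qed.

Definition G2_rv : {RV P >-> R} :=
  HB.pack_for {mfun T >-> R} (fun t => G2 g0 (X ^~ t))
    (isMeasurableFun.Build _ _ _ _ (fun t => G2 g0 (X ^~ t)) measurable_G2).

Lemma G2_rvE t : G2_rv t = G2 g0 (X ^~ t).
Proof. by []. Qed.

End G2_random_variable.

Definition mutually_independent (R : realType) (I : choiceType)
    (d d' : measure_display) (T : measurableType d) (T' : measurableType d')
    (P : probability T R) (X : I -> {RV P >-> T'}) : Prop :=
  forall (J : {fset I}) (B : I -> set T'),
    (forall i, i \in J -> measurable (B i)) ->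
    P (\bigcap_(i in [set` J]) (X i @^-1` B i)) =
    (\prod_(i <- J) P (X i @^-1` B i))%E.

(* Singular distributions are understood to be continuous. *)
Definition singular_continuous (R : realType) (mu : set R -> \bar R) : Prop :=
  (forall x, mu [set x] = 0%E) /\
  exists N : set R,
    [/\ measurable N, lebesgue_measure N = 0%E & mu (~` N) = 0%E].

(* Main.v *)
Require Import Defs.
From HB Require Import structures.
From mathcomp Require Import all_boot all_order all_algebra finmap.
From mathcomp Require Import all_classical all_reals all_analysis.
From mathcomp Require Import measurable_realfun ring lra.

Import Order.TTheory GRing.Theory Num.Theory.
Import numFieldNormedType.Exports.

Local Open Scope classical_set_scope.
Local Open Scope ring_scope.

(** Since [g0 + (1 - g0) = 1], the two maps [x |-> g0 x] and
    [x |-> g0 + (g0 - 1) x] cut [[0, g0]] into two intervals that share only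
    the point [g0 ^+ 2].  Iterating them along the words of length [n] cuts
    [[0, g0]] into [2 ^ n] closed cylinders with disjoint interiors, and the
    cylinder of the word [w] has length [g0 * Q w], where [Q w] is the product
    of the weights [g0] (digit 0) and [1 - g0] (digit 1).  Let [P w] be the
    probability that the first digits of the expansion spell [w].  The
    theorem is then Kakutani's dichotomy for the product measures [P] and [Q],
    proved here by hand on finite words.

    If the series converges, the second moments
    [\sum_w P w ^+ 2 / Q w = \prod_i (p0 i ^+ 2 / g0 + p1 i ^+ 2 / (1 - g0))]
    stay bounded by some [C].  From [P w <= eta * P w ^+ 2 / Q w + Q w / eta],
    summed over the cylinders inside an open set [U], the law of [U] is at most
    [eta * C + lambda U / (eta * g0)], where [lambda] is the Lebesgue measure
    ([G2_law_open_le]).  By outer regularity a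
    Lebesgue null set is then null for the law ([G2_law_dominated]).

    If the series diverges, the affinities
    [\sum_w sqrt (P w * Q w)
       = \prod_i (sqrt (p0 i * g0) + sqrt (p1 i * (1 - g0)))]
    tend to 0.  They bound both the Lebesgue measure of the union of the
    cylinders with [Q w < P w] and the mass that the law gives to the
    complement of this union, so that the upper limit of a subsequence of these
    unions carries the law and is Lebesgue null ([G2_law_singular]).

    Finally, a point lies in at most two cylinders of each length
    ([count_cylinder]), so that the hypothesis on the product of the maxima
    excludes atoms ([G2_law_atomless]). *)

(** * Finite binary words *)

(** The binary words of length [n], listed without repetition. *)
Fixpoint words (n : nat) : seq (seq bool) :=
  if n is m.+1 then
    [seq false :: w | w <- words m] ++ [seq true :: w | w <- words m]
  else [:: [::]].

Lemma mem_words n w : (w \in words n) = (size w == n).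
Proof.
elim: n w => [|n IH] [|b w] /=; rewrite ?inE//.
  by rewrite mem_cat; apply/negbTE; rewrite negb_or; apply/andP; split;
    apply/mapP => -[].
rewrite eqSS -IH mem_cat; case: b.
  rewrite orbC mem_map; last by move=> ? ? [].
  by case: (w \in words n) => //=; apply/mapP => -[].
rewrite mem_map; last by move=> ? ? [].
by case: (w \in words n) => //=; apply/mapP => -[].
Qed.

Lemma uniq_words n : uniq (words n).
Proof.
elim: n => //= n IH; rewrite cat_uniq !map_inj_uniq ?IH ?andbT//;
  try by move=> ? ? [].
by apply/hasPn => _ /mapP[w _ ->]; apply/mapP => -[].
Qed.

(** The product of the weights [F i b], where [b] is the digit of [w] at the
    position [i]. *)
Definition wprod {R : realType} (F : nat -> bool -> R) (w : seq bool) : R :=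
  \prod_(i < size w) F i (nth false w i).

Lemma wprod_nil {R : realType} (F : nat -> bool -> R) : wprod F [::] = 1.
Proof. exact: big_ord0. Qed.

Lemma wprod_cons {R : realType} (F : nat -> bool -> R) b w :
  wprod F (b :: w) = F 0 b * wprod (fun i => F i.+1) w.
Proof. by rewrite /wprod /= big_ord_recl. Qed.

Lemma wprod_ge0 {R : realType} (F : nat -> bool -> R) w :
  (forall i b, 0 <= F i b) -> 0 <= wprod F w.
Proof. by move=> F0; apply: prodr_ge0. Qed.

Lemma wprodM {R : realType} (F G : nat -> bool -> R) w :
  wprod F w * wprod G w = wprod (fun i b => F i b * G i b) w.
Proof. by rewrite /wprod -big_split. Qed.

Lemma wprod_sqrt {R : realType} (F : nat -> bool -> R) w :
  (forall i b, 0 <= F i b) ->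
  wprod (fun i b => Num.sqrt (F i b)) w = Num.sqrt (wprod F w).
Proof.
elim: w F => [|b w IH] F F0; first by rewrite !wprod_nil sqrtr1.
by rewrite !wprod_cons sqrtrM// IH.
Qed.

Lemma sum_wprod {R : realType} n (F : nat -> bool -> R) :
  \sum_(w <- words n) wprod F w = \prod_(i < n) (F i false + F i true).
Proof.
elim: n F => [|n IH] F /=; first by rewrite big_seq1 wprod_nil big_ord0.
rewrite big_cat !big_map /= big_ord_recl mulrDl.
under eq_bigr do rewrite wprod_cons.
rewrite -mulr_sumr IH; congr (_ + _).
by under eq_bigr do rewrite wprod_cons; rewrite -mulr_sumr IH.
Qed.

(** * Cylinders *)

Section cylinders.
Context {R : realType} {g0 : R}.
Context (g0_bounds : 2^-1 <= g0 < 1).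

Let g0_gt0 : 0 < g0. Proof. by case/andP: g0_bounds => ? _; lra. Qed.
Let g0_lt1 : g0 < 1. Proof. by case/andP: g0_bounds. Qed.

Lemma normr_G2_g b : `|G2_g g0 b| = if b then 1 - g0 else g0.
Proof.
case: b => /=; last by rewrite gtr0_norm.
by rewrite ltr0_norm ?opprB// subr_lt0.
Qed.

Lemma G2_g_neq0 b : G2_g g0 b != 0.
Proof. by rewrite -normr_gt0 normr_G2_g; case: ifP; rewrite ?subr_gt0. Qed.

(** The effect on the value of an expansion of prepending the digit [b]. *)
Definition G2_step (b : bool) (x : R) : R := G2_delta g0 b + G2_g g0 b * x.

(** The effect on the value of an expansion of prepending the word [w]. *)
Definition G2_map (w : seq bool) (x : R) : R := foldr G2_step x w.

(** The contraction ratio of [G2_map w]. *)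
Definition G2_len (w : seq bool) : R := wprod (fun=> fun b => `|G2_g g0 b|) w.

(** The values of the expansions that start with [w]. *)
Definition cylinder w := G2_map w @` [set x : R | 0 <= x <= g0].

(** The image of the open interval is the interior of the cylinder. *)
Definition open_cylinder w := G2_map w @` [set x : R | 0 < x < g0].

Lemma G2_len_gt0 w : 0 < G2_len w.
Proof. by apply: prodr_gt0 => i _ /=; rewrite normr_gt0 G2_g_neq0. Qed.

Lemma G2_len_cons b w : G2_len (b :: w) = `|G2_g g0 b| * G2_len w.
Proof. exact: wprod_cons. Qed.

Lemma G2_len_le w : G2_len w <= g0 ^+ size w.
Proof.
rewrite /G2_len /wprod -[in leRHS](card_ord (size w)) -prodr_const.
apply: ler_prod => i _; rewrite /= normr_ge0 normr_G2_g /=.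
by case: ifP => // _; case/andP: g0_bounds => ? _; lra.
Qed.

Lemma G2_mapB w x y : `|G2_map w x - G2_map w y| = G2_len w * `|x - y|.
Proof.
elim: w => [|b w IH] /=; first by rewrite /G2_len wprod_nil mul1r.
by rewrite /G2_step opprD addrACA subrr add0r -mulrBr normrM IH G2_len_cons mulrA.
Qed.

Lemma G2_map_surj w y : exists x, G2_map w x = y.
Proof.
elim: w y => [|b w IH] y; first by exists y.
have [x hx] := IH ((y - G2_delta g0 b) / G2_g g0 b).
exists x; rewrite /= hx /G2_step mulrCA divff ?G2_g_neq0// mulr1.
by rewrite addrC subrK.
Qed.

Lemma G2_step_itv b x : 0 <= x <= g0 -> 0 <= G2_step b x <= g0.
Proof.
have h0 := g0_gt0; have h1 := g0_lt1.
by rewrite /G2_step; case: b => /= /andP[x0 x1]; apply/andP; split; nra.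
Qed.

Lemma cylinder_rcons w b : cylinder (rcons w b) `<=` cylinder w.
Proof.
move=> _ [x x01 <-]; exists (G2_step b x); first exact: G2_step_itv.
by rewrite /G2_map foldr_rcons.
Qed.

Lemma cylinder_sub w : cylinder w `<=` [set x : R | 0 <= x <= g0].
Proof.
move=> _ [x x01 <-]; elim: w => //= b w IH; exact: G2_step_itv.
Qed.

Lemma open_cylinder_subset w : open_cylinder w `<=` cylinder w.
Proof. by apply: image_subset => x /= /andP[? ?]; rewrite !ltW. Qed.

Lemma cylinderE w :
  cylinder w = closed_ball (G2_map w (g0 / 2)) (g0 / 2 * G2_len w).
Proof.
have r0 : 0 < g0 / 2 * G2_len w by rewrite mulr_gt0 ?divr_gt0// G2_len_gt0.
rewrite closed_ballE//; apply/seteqP; split => y.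
  move=> [x /= x01 <-]; rewrite /closed_ball_ /= G2_mapB mulrC.
  by rewrite ler_pM2r ?G2_len_gt0// ler_norml; lra.
have [x <-] := G2_map_surj w y.
rewrite /closed_ball_ /= G2_mapB mulrC.
rewrite ler_pM2r ?G2_len_gt0// ler_norml => h; exists x => //=; lra.
Qed.

Lemma open_cylinderE w :
  open_cylinder w = ball (G2_map w (g0 / 2)) (g0 / 2 * G2_len w).
Proof.
apply/seteqP; split => y; rewrite -ball_normE /=.
  move=> [x /= x01 <-]; rewrite G2_mapB mulrC.
  by rewrite ltr_pM2r ?G2_len_gt0// ltr_norml; lra.
have [x <-] := G2_map_surj w y.
rewrite G2_mapB mulrC ltr_pM2r ?G2_len_gt0// ltr_norml => h.
by exists x => //=; lra.
Qed.

Lemma measurable_cylinder w : measurable (cylinder w).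
Proof. by rewrite cylinderE; exact: measurable_closed_ball. Qed.

Lemma measurable_open_cylinder w : measurable (open_cylinder w).
Proof. by rewrite open_cylinderE; exact: measurable_ball. Qed.

Lemma lebesgue_measure_cylinder w :
  lebesgue_measure (cylinder w) = (g0 * G2_len w)%:E.
Proof.
have := G2_len_gt0 w => l0; rewrite cylinderE lebesgue_measure_closed_ball.
  by congr EFin; rewrite -mulr_natr; field.
by rewrite mulr_ge0 ?divr_ge0// ltW.
Qed.

Lemma lebesgue_measure_open_cylinder w :
  lebesgue_measure (open_cylinder w) = (g0 * G2_len w)%:E.
Proof.
have := G2_len_gt0 w => l0; rewrite open_cylinderE lebesgue_measure_ball.
  by congr EFin; rewrite -mulr_natr; field.
by rewrite mulr_ge0 ?divr_ge0// ltW.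
Qed.

Lemma open_cylinder_itv w : open_cylinder w `<=` [set x : R | 0 < x < g0].
Proof.
move=> _ [x x01 <-]; elim: w => //= b w; rewrite /G2_step.
have h0 := g0_gt0; have h1 := g0_lt1.
by case: b => /= /andP[? ?]; apply/andP; split; nra.
Qed.

(** Open cylinders of the same length are disjoint. *)
Lemma open_cylinder_inj v w x : size v = size w ->
  open_cylinder v x -> open_cylinder w x -> v = w.
Proof.
elim: v w x => [|b v IH] [|c w] x //= [svw] [y y01 <-] [z z01].
have /open_cylinder_itv /= := imageP (G2_map v) y01.
have /open_cylinder_itv /= := imageP (G2_map w) z01.
move=> wz vy; rewrite /= => hx.
have bc : b = c.
  move: hx wz vy; rewrite /G2_step.
  move: (G2_map v y) (G2_map w z) => r s.
  have h0 := g0_gt0; have h1 := g0_lt1; clear -h0 h1.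
  by case: b c => -[] //= hx /andP[? ?] /andP[? ?]; exfalso; nra.
congr (_ :: _) => //; apply: (IH w (G2_map v y)) => //; first by exists y.
exists z => //; move: hx; rewrite bc => /addrI; apply: mulfI; exact: G2_g_neq0.
Qed.

(** By disjointness of the open cylinders, the total length of the cylinders
    of order [n] inside [U] is at most the measure of [U]. *)
Lemma sum_G2_len_le (W : pred (seq bool)) n (U : set R) : measurable U ->
  (forall w, W w -> cylinder w `<=` U) ->
  ((\sum_(w <- words n | W w) g0 * G2_len w)%:E <= lebesgue_measure U)%E.
Proof.
move=> mU WU.
pose A := [fset w in [seq w <- words n | W w]]%fset.
have memA w : (w \in A) = (w \in [seq w <- words n | W w]) by rewrite inE.
have -> : \sum_(w <- words n | W w) g0 * G2_len w = \sum_(w <- A) g0 * G2_len w.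
  rewrite -big_filter; apply: perm_big; apply: uniq_perm => //.
  - by rewrite filter_uniq// uniq_words.
  - exact: fset_uniq.
rewrite -sumEFin.
under eq_bigr do rewrite -lebesgue_measure_open_cylinder.
rewrite -measure_fbigsetU.
- apply: le_measure; rewrite ?inE//.
    by apply: bigsetU_measurable => w _; exact: measurable_open_cylinder.
  rewrite -bigcup_fset => x [w /=]; rewrite memA mem_filter => /andP[Ww _].
  by move/open_cylinder_subset; exact: WU.
- by move=> w _; exact: measurable_open_cylinder.
- move=> v w /=; rewrite !memA !mem_filter !mem_words.
  move=> /andP[_ /eqP vn] /andP[_ /eqP wn].
  by move=> [x [vx wx]]; apply: (@open_cylinder_inj _ _ x) => //; rewrite vn wn.
Qed.

Lemma cylinder_cons b w x :
  cylinder (b :: w) x <-> cylinder w ((x - G2_delta g0 b) / G2_g g0 b).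
Proof.
split=> [[y y01 <-]|[y y01 hy]]; exists y => //.
  by rewrite /= /G2_step addrAC subrr add0r mulrAC divff ?mul1r// G2_g_neq0.
by rewrite /= hy /G2_step mulrCA divff ?G2_g_neq0// mulr1 addrC subrK.
Qed.

(* The number of cylinders of order [n] that contain [x]. *)
Let ncyl n x : nat := count (fun w => `[< cylinder w x >]) (words n).

Let ncylS n x : ncyl n.+1 x = (ncyl n (x / g0) + ncyl n ((x - g0) / (g0 - 1)))%N.
Proof.
rewrite /ncyl /= count_cat !count_map; congr (_ + _)%N; apply: eq_count => w /=.
  by apply: asbool_equiv_eq; rewrite cylinder_cons /= subr0.
by apply: asbool_equiv_eq; rewrite cylinder_cons.
Qed.

Let ncyl_out n x : ~~ (0 <= x <= g0) -> ncyl n x = 0%N.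
Proof.
move=> xout; rewrite /ncyl (@eq_count _ _ xpred0) ?count_pred0// => w /=.
by apply/asboolP => /cylinder_sub /=; apply/negP.
Qed.

Let ncyl0 n : (ncyl n 0 <= 1)%N.
Proof.
elim: n => [|n IH]; first exact: count_size.
rewrite ncylS mul0r (@ncyl_out n ((0 - g0) / (g0 - 1))) ?addn0//.
rewrite negb_and -!ltNge sub0r -opprB divrNN ltr_pdivlMr ?subr_gt0//.
by apply/orP; right; case/andP: g0_bounds => ? ?; nra.
Qed.

Let ncylg0 n : (ncyl n g0 <= 1)%N.
Proof.
case: n => [|n]; first exact: count_size.
rewrite ncylS subrr mul0r (@ncyl_out n (g0 / g0)) ?add0n//.
by rewrite negb_and -!ltNge divff ?gt_eqF// g0_lt1 orbT.
Qed.

(** Only the common endpoint [g0 ^+ 2] of the two cylinders of order 1 belongs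
    to both; it is the image of the endpoint [g0] under both maps, and an
    endpoint of [[0, g0]] lies in at most one cylinder of each order. *)
Lemma count_cylinder n x :
  (count (fun w => `[< cylinder w x >]) (words n) <= 2)%N.
Proof.
rewrite -/(ncyl n x); elim: n x => [|n IH] x.
  exact: (leq_trans (count_size _ _)).
rewrite ncylS; have [xg|xg|->] := ltgtP x (g0 * g0).
- rewrite (@ncyl_out n ((x - g0) / (g0 - 1))) ?addn0//.
  rewrite negb_and -!ltNge -opprB -[g0 - 1]opprB divrNN ltr_pdivlMr ?subr_gt0//.
  by apply/orP; right; nra.
- rewrite (@ncyl_out n (x / g0)) ?add0n//.
  by rewrite negb_and -!ltNge ltr_pdivlMr// xg orbT.
- rewrite mulfK ?gt_eqF// (_ : (_ - _) / _ = g0); last first.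
    by field; rewrite subr_eq0 lt_eqF.
  exact: (leq_add (ncylg0 n) (ncylg0 n)).
Qed.

Lemma series_G2_termS (a : nat -> bool) n :
  series (G2_term g0 a) n.+1 = G2_step (a 0) (series (G2_term g0 (a \o S)) n).
Proof.
rewrite /series /= big_nat_recl// big_mkord /G2_step; congr (_ + _).
  by rewrite /G2_term big_ord0 mulr1.
rewrite big_mkord mulr_sumr; apply: eq_bigr => i _.
by rewrite /G2_term big_ord_recl /= mulrCA.
Qed.

Lemma G2_shift (a : nat -> bool) : G2 g0 a = G2_step (a 0) (G2 g0 (a \o S)).
Proof.
have H := @is_cvg_series_G2_term R g0 (a \o S) g0_bounds.
apply/cvg_lim => //; rewrite -cvg_shiftS /=.
under eq_fun do rewrite series_G2_termS.
by apply: cvgD; [exact: cvg_cst|apply: cvgM; [exact: cvg_cst|exact: H]].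
Qed.

Lemma G2_itv (a : nat -> bool) : 0 <= G2 g0 a <= g0.
Proof.
have S01 n : 0 <= series (G2_term g0 a) n <= g0.
  elim: n a => [|n IH] a; first by rewrite /series /= big_geq// lexx ltW.
  by rewrite series_G2_termS G2_step_itv.
have H := @is_cvg_series_G2_term R g0 a g0_bounds.
by apply/andP; split; [apply: limr_ge|apply: limr_le] => //;
  apply: nearW => n; case/andP: (S01 n).
Qed.

Lemma cylinder_mkseq (a : nat -> bool) n : cylinder (mkseq a n) (G2 g0 a).
Proof.
elim: n a => [|n IH] a; first by exists (G2 g0 a) => //; exact: G2_itv.
rewrite G2_shift; have [x x01 hx] := IH (a \o S).
exists x => //=;
by rewrite /mkseq /= (iotaDl 1 0 n) -map_comp -hx.
Qed.

End cylinders.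

(** * Two facts on measures *)

Lemma measure_bigsetU_le {d} {T : measurableType d} {R : realType}
    (mu : {measure set T -> \bar R}) (I : Type) (s : seq I) (W : pred I)
    (F : I -> set T) : (forall i, measurable (F i)) ->
  (mu (\big[setU/set0]_(i <- s | W i) F i) <= \sum_(i <- s | W i) mu (F i))%E.
Proof.
move=> mF; elim: s => [|i s IH]; first by rewrite !big_nil measure0.
rewrite !big_cons; case: ifP => // _.
apply: (le_trans (measureU2 _ (mF i) _)); first exact: bigsetU_measurable.
exact: leeD2l.
Qed.

(** By the Borel-Cantelli lemma, the upper limit of the sets [B k] is
    [mu]-null and has full measure for the image of [nu] under [f]. *)
Lemma limsup_null_cofull {d d'} {T : measurableType d} {T' : measurableType d'}
    {R : realType} (mu : {measure set T -> \bar R})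
    (nu : {measure set T' -> \bar R}) (f : T' -> T) (B : nat -> set T) :
  (forall A, measurable A -> measurable (f @^-1` A)) ->
  (forall k, measurable (B k)) ->
  (forall k, (mu (B k) <= (1 / (2 ^ k.+1)%:R)%:E)%E) ->
  (forall k, (nu (f @^-1` ~` B k) <= (1 / (2 ^ k.+1)%:R)%:E)%E) ->
  exists N, [/\ measurable N, mu N = 0%E & nu (f @^-1` ~` N) = 0%E].
Proof.
move=> mf mB muB nuB.
have mU n : measurable (\bigcup_(j in [set j | (n <= j)%N]) B j).
  exact: bigcup_measurable.
have mN : measurable (lim_sup_set B) by exact: bigcapT_measurable.
exists (lim_sup_set B); split=> //.
- apply: lim_sup_set_cvg0 => //.
  apply: (@le_lt_trans _ _ 1%E); last exact: ltry.
  apply: le_trans (epsilon_trick0 xpredT (@ler01 R)).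
  exact: lee_nneseries.
- apply/negligibleP; first by apply: mf; exact: measurableC.
  rewrite setC_bigcap preimage_bigcup; apply: negligible_bigcup => n.
  apply/negligibleP; first by apply: mf; exact: measurableC.
  apply/eqP; rewrite eq_le measure_ge0 andbT; apply/lee_addgt0Pr => e e0.
  rewrite add0e.
  have half : `|2^-1 : R| < 1 by rewrite ger0_norm ?invr_ge0// invf_lt1 ?ltr1n.
  have /cvgrPdist_lt /(_ e e0) [k _ hk] := cvg_expr half.
  pose j := maxn n k; have := hk j (leq_maxr _ _).
  rewrite /= sub0r normrN normrX ger0_norm ?invr_ge0// => je.
  apply: (@le_trans _ _ (nu (f @^-1` ~` B j))).
    apply: le_measure; rewrite ?inE; [by apply: mf; exact: measurableC..|].
    apply: preimage_subset; apply: subsetC => x Bjx; exists j => //=.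
    exact: leq_maxl.
  apply: (le_trans (nuB j)); rewrite lee_fin (le_trans _ (ltW je))//.
  rewrite div1r natrX -exprVn exprS ler_piMl ?exprn_ge0 ?invr_ge0//.
  by rewrite invf_le1 ?ler1n.
Qed.

(** * The law of a random expansion *)

Section digits.
Context {R : realType} {g0 : R} {d : measure_display} {T : measurableType d}
  {P : probability T R} {X : nat -> {RV P >-> bool}} {p0 p1 : nat -> R}.
Context (g0_bounds : 2^-1 <= g0 < 1)
  (indepX : mutually_independent X)
  (p0_ge0 : forall n, 0 <= p0 n) (p1_ge0 : forall n, 0 <= p1 n)
  (X_p0 : forall n, P [set t | X n t = false] = (p0 n)%:E)
  (X_p1 : forall n, P [set t | X n t = true] = (p1 n)%:E).

Let g0_gt0 : 0 < g0. Proof. by case/andP: g0_bounds => ? _; lra. Qed.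
Let g0_lt1 : g0 < 1. Proof. by case/andP: g0_bounds. Qed.

(* [wprod p w] is the probability of the prefix [w], while [g0 * wprod q w] is
   the length of its cylinder. *)
Let p i (b : bool) : R := if b then p1 i else p0 i.
Let q (i : nat) (b : bool) : R := `|G2_g g0 b|.
Let law := distribution P (G2_rv X g0_bounds).

Let p_ge0 i b : 0 <= p i b. Proof. by rewrite /p; case: b. Qed.
Let q_gt0 i b : 0 < q i b.
Proof. by rewrite /q normr_gt0 (G2_g_neq0 g0_bounds). Qed.

Let measurable_digit n b : measurable [set t | X n t = b].
Proof.
have : measurable (X n @^-1` [set b]) by exact: measurable_funPTI.
by [].
Qed.

Let prefixE n w : size w = n ->
  [set t | mkseq (X ^~ t) n = w] =
  \bigcap_(i in [set` [fset i in iota 0 n]%fset])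
    (X i @^-1` [set nth false w i]).
Proof.
move=> wn; apply/seteqP; split => t /= ht.
  move=> i /=; rewrite !inE mem_iota add0n => /= iltn.
  by rewrite -ht nth_mkseq.
apply: (@eq_from_nth _ false); rewrite size_mkseq// => i iltn.
by rewrite nth_mkseq//; apply: ht; rewrite /= !inE mem_iota.
Qed.

Lemma measurable_prefix n w : measurable [set t | mkseq (X ^~ t) n = w].
Proof.
have [/eqP wn|wn] := boolP (size w == n).
  rewrite (prefixE _ _ wn); apply: fin_bigcap_measurable.
    exact: finite_fset.
  by move=> i _; exact: measurable_digit.
rewrite (_ : [set _ | _] = set0)//; apply/seteqP; split => // t /= tw.
by move: wn; rewrite -tw size_mkseq eqxx.
Qed.

Lemma probability_prefix n w : size w = n ->
  P [set t | mkseq (X ^~ t) n = w] = (wprod p w)%:E.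
Proof.
move=> wn; rewrite (prefixE _ _ wn) indepX//.
rewrite (eq_bigr (fun i => (p i (nth false w i))%:E)); last first.
  by move=> i _; rewrite /p; case: nth; [exact: X_p1|exact: X_p0].
rewrite prodEFin; congr EFin; rewrite /wprod wn.
rewrite -(big_mkord xpredT (fun i => p i (nth false w i))).
apply: perm_big; apply: uniq_perm; [exact: fset_uniq|exact: iota_uniq|].
by move=> i; rewrite inE /index_iota subn0.
Qed.

(** The event that the first [n] digits form a word that satisfies [W]. *)
Definition prefix_event n (W : pred (seq bool)) := [set t | W (mkseq (X ^~ t) n)].

Lemma prefix_eventE n W : prefix_event n W =
  \big[setU/set0]_(w <- words n | W w) [set t | mkseq (X ^~ t) n = w].
Proof.
rewrite -bigcup_seq_cond; apply/seteqP; split => t /=.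
  by move=> Wt; exists (mkseq (X ^~ t) n) => //=; rewrite mem_words size_mkseq eqxx.
by move=> [w /= /andP[_ Ww] wt]; rewrite /prefix_event /= wt.
Qed.

Lemma measurable_prefix_event n W : measurable (prefix_event n W).
Proof.
rewrite prefix_eventE; apply: bigsetU_measurable => w _; exact: measurable_prefix.
Qed.

Lemma probability_prefix_event_le n W :
  (P (prefix_event n W) <= (\sum_(w <- words n | W w) wprod p w)%:E)%E.
Proof.
rewrite prefix_eventE; apply: le_trans; first apply: measure_bigsetU_le.
  by move=> w; exact: measurable_prefix.
rewrite -sumEFin le_eqVlt; apply/orP; left; apply/eqP.
rewrite big_seq_cond [RHS]big_seq_cond; apply: eq_bigr => w.
by rewrite mem_words => /andP[/eqP wn _]; exact: probability_prefix.
Qed.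

Let measurable_G2_preimage (A : set R) :
  measurable A -> measurable (G2_rv X g0_bounds @^-1` A).
Proof. exact: measurable_funPTI. Qed.

Let law_le (A : set R) (E : set T) : measurable A -> measurable E ->
  G2_rv X g0_bounds @^-1` A `<=` E -> (law A <= P E)%E.
Proof.
move=> mA mE AE; rewrite /law /distribution /pushforward.
by apply: le_measure; rewrite ?inE//; exact: measurable_G2_preimage.
Qed.

Lemma wprod_le_max w : wprod p w <= \prod_(i < size w) Num.max (p0 i) (p1 i).
Proof.
apply: ler_prod => i _; rewrite p_ge0 /p /=.
by case: nth; rewrite le_max lexx ?orbT.
Qed.

(** A point lies in at most two cylinders of order [n], each of mass at most
    the product of the first [n] maxima. *)
Lemma G2_law_atomless x :
  \prod_(0 <= k < n) Num.max (p0 k) (p1 k) @[n --> \oo] --> (0 : R) ->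
  law [set x] = 0%E.
Proof.
move=> M0.
have bound n : (law [set x] <= (2 * \prod_(0 <= k < n) Num.max (p0 k) (p1 k))%:E)%E.
  pose W w := `[< cylinder (g0 := g0) w x >].
  apply: (@le_trans _ _ (P (prefix_event n W))).
    apply: law_le => //; first exact: measurable_prefix_event.
    move=> t /= xt; rewrite /prefix_event /W -xt; apply/asboolP; exact: cylinder_mkseq.
  apply: (le_trans (probability_prefix_event_le _ _)); rewrite lee_fin big_mkord.
  set M := \prod_(i < n) _.
  have M_ge0 : 0 <= M by apply: prodr_ge0 => i _; rewrite le_max p0_ge0.
  apply: (@le_trans _ _ (\sum_(w <- words n | W w) M)).
    rewrite big_seq_cond [leRHS]big_seq_cond; apply: ler_sum => w.
    by rewrite mem_words => /andP[/eqP wn _]; rewrite /M -wn wprod_le_max.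
  rewrite big_const_seq iter_addr addr0 -[M *+ _]mulr_natl ler_wpM2r// ler_nat.
  exact: count_cylinder.
have lim0 : 2 * \prod_(0 <= k < n) Num.max (p0 k) (p1 k) @[n --> \oo] --> (0 : R).
  by rewrite -[X in _ --> X](mulr0 2); apply: cvgM => //; exact: cvg_cst.
apply/eqP; rewrite eq_le measure_ge0 andbT; apply/lee_addgt0Pr => e e0.
rewrite add0e; move/cvgrPdist_lt : lim0 => /(_ e e0) [n _ hn].
have := hn n (leqnn n); rewrite /= sub0r normrN => /(le_lt_trans (ler_norm _)) he.
by apply: (le_trans (bound n)); rewrite lee_fin ltW.
Qed.

(** Every value in the open set [U] has a whole cylinder around it inside [U],
    so that the law of [U] is the limit of the probabilities that the cylinder
    of the first [n] digits lies in [U]. *)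
Lemma G2_law_open_le (C eta e : R) (U : set R) : 0 < eta -> open U ->
  (forall n, \prod_(i < n) (p0 i ^+ 2 / g0 + p1 i ^+ 2 / (1 - g0)) <= C) ->
  (lebesgue_measure U <= e%:E)%E ->
  (law U <= (eta * C + e / (eta * g0))%:E)%E.
Proof.
move=> eta0 oU leC Ue.
have mU : measurable U by exact: open_measurable.
pose W w := `[< cylinder (g0 := g0) w `<=` U >].
have step n : (P (prefix_event n W) <= (eta * C + e / (eta * g0))%:E)%E.
  apply: (le_trans (probability_prefix_event_le _ _)); rewrite lee_fin.
  pose r i b := p i b ^+ 2 / q i b.
  have r_ge0 i b : 0 <= r i b by rewrite divr_ge0 ?sqr_ge0 ?ltW.
  have ptw w : wprod p w <= eta * wprod r w + eta^-1 * wprod q w.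
    have q0 : 0 < wprod q w by apply: prodr_gt0 => i _.
    have -> : wprod r w = wprod p w ^+ 2 / wprod q w.
      by rewrite /wprod -prodfV -prodrXl -big_split.
    have := wprod_ge0 p w p_ge0.
    move: (wprod p w) (wprod q w) q0 => a b b0.
    move=> a0; rewrite -subr_ge0.
    (* After multiplication by [eta * b] the claim reads
       [(eta * a) * b <= (eta * a) ^+ 2 + b ^+ 2]. *)
    have -> : eta * (a ^+ 2 / b) + eta^-1 * b - a =
      ((eta * a - b) ^+ 2 + (eta * a) * b) / (eta * b) by field; rewrite !gt_eqF.
    apply: divr_ge0; last by rewrite ltW// mulr_gt0.
    by rewrite addr_ge0 ?sqr_ge0// mulr_ge0 ?(ltW b0)// mulr_ge0// ltW.
  apply: (@le_trans _ _ (eta * \sum_(w <- words n) wprod r w +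
      eta^-1 * \sum_(w <- words n | W w) wprod q w)).
    apply: (@le_trans _ _ (\sum_(w <- words n | W w)
       (eta * wprod r w + eta^-1 * wprod q w))); first exact: ler_sum.
    rewrite big_split /= -!mulr_sumr lerD2r ler_pM2l//.
    rewrite [leRHS](bigID W) /= lerDl; apply: sumr_ge0 => w _; exact: wprod_ge0.
  apply: lerD.
    rewrite ler_pM2l// sum_wprod; apply: le_trans (leC n).
    by apply: ler_prod => i _; rewrite addr_ge0//= /r /p /q !(normr_G2_g g0_bounds).
  have WU w : W w -> cylinder (g0 := g0) w `<=` U by move/asboolP.
  have := le_trans (sum_G2_len_le g0_bounds W n U mU WU) Ue.
  rewrite lee_fin -mulr_sumr => h.
  rewrite invfM mulrCA ler_pM2l ?invr_gt0//.
  by rewrite ler_pdivlMr// mulrC.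
have subS n : prefix_event n W `<=` prefix_event n.+1 W.
  move=> t /asboolP h; apply/asboolP; apply: subset_trans h.
  rewrite -[n.+1]addn1 /mkseq iotaD map_cat cats1; exact: cylinder_rcons.
have incr : {homo (fun n => prefix_event n W) : n m / (n <= m)%N >-> (n <= m)%O}.
  move=> n m /subnKC <-; apply/subsetPset; elim: (m - n)%N => [|k IH].
    by rewrite addn0.
  by rewrite addnS; apply: subset_trans (subS _).
have mE n := measurable_prefix_event n W.
apply: (@le_trans _ _ (P (\bigcup_n prefix_event n W))).
  apply: law_le => //; first exact: bigcupT_measurable.
  move=> t /= Ut; have /nbhs_ballP[r /= r0 rU] : nbhs (G2_rv X g0_bounds t) U.
    exact: open_nbhs_nbhs.
  have g0n : `|g0| < 1 by rewrite gtr0_norm.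
  have /cvgrPdist_lt /(_ r r0) [n _ /(_ n (leqnn n))] := cvg_expr g0n.
  rewrite /= sub0r normrN normrX gtr0_norm// => rn.
  exists n => //; apply/asboolP => y cy; apply: rU; rewrite -ball_normE /=.
  have := cylinder_mkseq g0_bounds (X ^~ t) n.
  move: cy => [u /= u01 <-] [v /= v01]; move=> <-.
  rewrite G2_mapB; apply: le_lt_trans rn.
  have := G2_len_le g0_bounds (mkseq (X ^~ t) n); rewrite size_mkseq => ln.
  have l0 := G2_len_gt0 g0_bounds (mkseq (X ^~ t) n).
  apply: le_trans ln; rewrite ler_piMr ?(ltW l0)//.
  have h1 := g0_lt1; rewrite ler_norml; lra.
have := nondecreasing_cvg_mu mE (bigcupT_measurable _ mE) incr (mu := P).
move/cvg_lim => <-//; apply: lime_le; last exact: nearW.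
apply: cvgP; exact: nondecreasing_cvg_mu mE (bigcupT_measurable _ mE) incr.
Qed.

Lemma G2_law_dominated (C : R) :
  (forall n, \prod_(i < n) (p0 i ^+ 2 / g0 + p1 i ^+ 2 / (1 - g0)) <= C) ->
  law `<< lebesgue_measure.
Proof.
move=> leC; apply/null_content_dominatesP => N mN N0.
have C1 : 0 < C + 1.
  have := leC 0%N; rewrite big_ord0 => ?; lra.
apply/eqP; rewrite eq_le measure_ge0 andbT; apply/lee_addgt0Pr => e e0.
rewrite add0e.
(* With [lambda U < eta ^+ 2 * g0] the bound on the law of [U] becomes
   [eta * C + eta], which is [e]. *)
pose eta := e / (C + 1).
have eta0 : 0 < eta by rewrite divr_gt0.
have [||U [oU NU Ueps]] := @lebesgue_regularity_outer R N (eta ^+ 2 * g0) mN.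
- by rewrite N0 ltry.
- by rewrite mulr_gt0// exprn_gt0.
have mU : measurable U by exact: open_measurable.
apply: (@le_trans _ _ (law U)).
  apply: le_measure; rewrite ?inE//.
apply: (le_trans (G2_law_open_le C eta (eta ^+ 2 * g0) U eta0 oU leC _)).
  apply: (@le_trans _ _ (lebesgue_measure ((U `\` N) `|` N))).
    apply: le_measure; rewrite ?inE//.
      by apply: measurableU => //; exact: measurableD.
    by move=> x Ux; have [Nx|Nx] := pselect (N x); [right|left].
  apply: (le_trans (measureU2 _ _ _)) => //; first exact: measurableD.
  by rewrite N0 adde0 ltW.
rewrite lee_fin (_ : _ + _ = e)// /eta; field.
by rewrite !gt_eqF.
Qed.

Lemma G2_law_singular :
  (forall e, 0 < e -> exists n,
    \prod_(i < n) (Num.sqrt (p0 i * g0) + Num.sqrt (p1 i * (1 - g0))) <= e) ->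
  exists N : set R, [/\ measurable N, lebesgue_measure N = 0%E & law (~` N) = 0%E].
Proof.
move=> aff.
pose W w := wprod q w < wprod p w.
pose B n := \big[setU/set0]_(w <- words n | W w) cylinder (g0 := g0) w.
have mB n : measurable (B n).
  by apply: bigsetU_measurable => w _; exact: measurable_cylinder.
pose r i b := Num.sqrt (p i b * q i b).
have r_ge0 i b : 0 <= r i b by exact: sqrtr_ge0.
have rE w : wprod r w = Num.sqrt (wprod p w * wprod q w).
  by rewrite wprodM wprod_sqrt// => i b; rewrite mulr_ge0// ltW.
have sum_r n : \sum_(w <- words n) wprod r w =
    \prod_(i < n) (Num.sqrt (p0 i * g0) + Num.sqrt (p1 i * (1 - g0))).
  by rewrite sum_wprod; apply: eq_bigr => i _; rewrite /r /p /q !(normr_G2_g g0_bounds).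
have sub_r n (V : pred (seq bool)) :
    \sum_(w <- words n | V w) wprod r w <= \sum_(w <- words n) wprod r w.
  rewrite [leRHS](bigID V) /= lerDl; apply: sumr_ge0 => w _; exact: wprod_ge0.
have lebB n : (lebesgue_measure (B n) <= (\sum_(w <- words n) wprod r w)%:E)%E.
  apply: le_trans; first apply: measure_bigsetU_le.
    by move=> w; exact: measurable_cylinder.
  rewrite (eq_bigr (fun w => (g0 * G2_len (g0 := g0) w)%:E)); last first.
    by move=> w _; exact: lebesgue_measure_cylinder.
  rewrite sumEFin lee_fin; apply: le_trans (sub_r n W).
  apply: ler_sum => w Ww.
  have q0 : 0 < wprod q w by apply: prodr_gt0 => i _.
  apply: (@le_trans _ _ (wprod q w)); first by rewrite ler_piMl// ltW.
  rewrite rE -[leLHS](ger0_norm (ltW q0)) -sqrtr_sqr ler_wsqrtr// expr2.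
  by rewrite ler_pM2r// ltW.
have lawB n : (law (~` B n) <= (\sum_(w <- words n) wprod r w)%:E)%E.
  apply: (@le_trans _ _ (P (prefix_event n (predC W)))).
    apply: law_le; [exact: measurableC|exact: measurable_prefix_event|].
    move=> t /= nBt; apply/negP => Wt; apply: nBt.
    rewrite /B -bigcup_seq_cond; exists (mkseq (X ^~ t) n); last exact: cylinder_mkseq.
    by rewrite /= mem_words size_mkseq eqxx.
  apply: (le_trans (probability_prefix_event_le _ _)); rewrite lee_fin.
  apply: le_trans (sub_r n (predC W)); apply: ler_sum => w; rewrite /= -leNgt => Ww.
  have wp0 := wprod_ge0 p w p_ge0.
  by rewrite rE -[leLHS](ger0_norm wp0) -sqrtr_sqr ler_wsqrtr// expr2 ler_wpM2l.
have e0 k : 0 < (1 / (2 ^ k.+1)%:R : R) by rewrite divr_gt0// ltr0n expn_gt0.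
have [n hn] := choice (fun k => aff _ (e0 k)).
apply: (limsup_null_cofull lebesgue_measure P (G2_rv X g0_bounds)
  (fun k => B (n k))) => [A mA|k|k|k].
- exact: measurable_G2_preimage.
- exact: mB.
- by apply: (le_trans (lebB _)); rewrite lee_fin sum_r.
- by apply: (le_trans (lawB _)); rewrite lee_fin sum_r.
Qed.

End digits.

(** * Comparing the terms of the series with the factors of the products *)

(** With [s = (p - g) ^+ 2], the left-hand side is [1 + s / (g * (1 - g))] and
    the exponent is [s * (g ^- 2 + (1 - g) ^- 2)]. *)
Lemma chi2_term_le {R : realType} (g p r : R) : 0 < g < 1 -> p + r = 1 ->
  p ^+ 2 / g + r ^+ 2 / (1 - g) <=
  expR ((1 - p / g) ^+ 2 + (1 + r / (g - 1)) ^+ 2).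
Proof.
move=> /andP[g0 g1] /(canRL (addKr _)) ->.
have h0 : 0 < 1 - g by rewrite subr_gt0.
have n0 : g != 0 by rewrite gt_eqF.
have n1 : 1 - g != 0 by rewrite gt_eqF.
have n2 : g - 1 != 0 by rewrite lt_eqF// subr_lt0.
apply: le_trans (expR_ge1Dx _).
pose s := (p - g) ^+ 2.
have -> : p ^+ 2 / g + (- p + 1) ^+ 2 / (1 - g) = 1 + s * (g^-1 * (1 - g)^-1).
  by rewrite /s; field; rewrite n0 n1.
have -> : (1 - p / g) ^+ 2 + (1 + (- p + 1) / (g - 1)) ^+ 2 =
   s * (g^-1 ^+ 2 + (1 - g)^-1 ^+ 2).
  by rewrite /s; field; rewrite ?n0 ?n1 ?n2.
rewrite lerD2l ler_wpM2l ?sqr_ge0//.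
have : 0 < g^-1 by rewrite invr_gt0.
have : 0 < (1 - g)^-1 by rewrite invr_gt0.
move: g^-1 (1 - g)^-1 => a b; nra.
Qed.

(** The exponent is [- (p - g) ^+ 2 / 4]: if [x, y, a, b] are the square roots
    of [p, r, g, 1 - g], then [1 - (x * a + y * b)] is half the sum of
    [(x - a) ^+ 2] and [(y - b) ^+ 2], and each of these squares is at least
    [(p - g) ^+ 2 / 4]. *)
Lemma affinity_le {R : realType} (g p r : R) : 0 < g < 1 ->
  0 <= p -> 0 <= r -> p + r = 1 ->
  Num.sqrt (p * g) + Num.sqrt (r * (1 - g)) <=
  expR (- (((1 - p / g) ^+ 2 + (1 + r / (g - 1)) ^+ 2) /
           (4 * (g^-1 ^+ 2 + (1 - g)^-1 ^+ 2)))).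
Proof.
move=> /andP[g0 g1] p0 r0 pr.
have h0 : 0 < 1 - g by rewrite subr_gt0.
have n0 : g != 0 by rewrite gt_eqF.
have n1 : 1 - g != 0 by rewrite gt_eqF.
have n2 : g - 1 != 0 by rewrite lt_eqF// subr_lt0.
have K0 : 0 < g^-1 ^+ 2 + (1 - g)^-1 ^+ 2.
  by rewrite addr_gt0// exprn_gt0// invr_gt0.
apply: le_trans (expR_ge1Dx _).
have -> : (1 - p / g) ^+ 2 + (1 + r / (g - 1)) ^+ 2 =
   (p - g) ^+ 2 * (g^-1 ^+ 2 + (1 - g)^-1 ^+ 2).
  move: pr => /(canRL (addKr _)) ->.
  by field; rewrite ?n0 ?n1 ?n2.
move: (_ + _ ^+ 2) K0 => k k0.
have -> : (p - g) ^+ 2 * k / (4 * k) = (p - g) ^+ 2 / 4 by field; rewrite gt_eqF.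
rewrite !sqrtrM//.
have := sqrtr_ge0 p; have := sqrtr_ge0 r; have := sqrtr_ge0 g.
have := sqrtr_ge0 (1 - g); have := sqr_sqrtr p0; have := sqr_sqrtr r0.
have := sqr_sqrtr (ltW g0); have := sqr_sqrtr (ltW h0).
move: (Num.sqrt p) (Num.sqrt r) (Num.sqrt g) (Num.sqrt (1 - g)).
move=> x y a b bE aE yE xE b0 a0 y0 x0.
have key (z w : R) : 0 <= z -> 0 <= w -> z ^+ 2 <= 1 -> w ^+ 2 <= 1 ->
    (z ^+ 2 - w ^+ 2) ^+ 2 <= 4 * (z - w) ^+ 2.
  move=> z0 w0 z1 w1; rewrite subr_sqr exprMn mulrC ler_wpM2r ?sqr_ge0//; nra.
have h1 := key x a x0 a0; have h2 := key y b y0 b0.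
have {}h1 : (p - g) ^+ 2 <= 4 * (x - a) ^+ 2.
  by rewrite -xE -aE; apply: h1; lra.
have {}h2 : (p - g) ^+ 2 <= 4 * (y - b) ^+ 2.
  rewrite (_ : p - g = - (y ^+ 2 - b ^+ 2)); last lra.
  by rewrite sqrrN; apply: h2; lra.
have -> : x * a + y * b =
    (x ^+ 2 + y ^+ 2 + (a ^+ 2 + b ^+ 2) - ((x - a) ^+ 2 + (y - b) ^+ 2)) / 2.
  by field.
rewrite xE yE aE bE pr; lra.
Qed.

Theorem theorem16 (R : realType) (g0 : R) (g0_bounds : 2^-1 <= g0 < 1)
    (d : measure_display) (T : measurableType d) (P : probability T R)
    (xi_ : nat -> {RV P >-> bool}) (p0 p1 : nat -> R)
    (xi_indep : mutually_independent xi_)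
    (p0_ge0 : forall n, 0 <= p0 n) (p1_ge0 : forall n, 0 <= p1 n)
    (p0Dp1 : forall n, p0 n + p1 n = 1)
    (xi_p0 : forall n, P [set t | xi_ n t = false] = (p0 n)%:E)
    (xi_p1 : forall n, P [set t | xi_ n t = true] = (p1 n)%:E)
    (M_eq0 : \prod_(0 <= k < n) Num.max (p0 k) (p1 k) @[n --> \oo] --> (0 : R)) :
  let g1 := g0 - 1 in
  let law := distribution P (G2_rv xi_ g0_bounds) in
  (law `<< lebesgue_measure \/ singular_continuous law) /\
  (law `<< lebesgue_measure <->
   (\sum_(0 <= n <oo)
      ((1 - p0 n / g0) ^+ 2 + (1 + p1 n / g1) ^+ 2)%:E < +oo)%E).
Proof.
move=> g1 law.
have g0_gt0 : 0 < g0 by case/andP: (g0_bounds) => ? _; lra.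
have g0_lt1 : g0 < 1 by case/andP: (g0_bounds).
have g01 : 0 < g0 < 1 by rewrite g0_gt0.
pose u n := (1 - p0 n / g0) ^+ 2 + (1 + p1 n / g1) ^+ 2.
have u_ge0 n : 0 <= u n by rewrite addr_ge0 ?sqr_ge0.
have uE_ge0 n : (0 <= (u n)%:E)%E by rewrite lee_fin.
rewrite -/u.
have acP : (\sum_(0 <= n <oo) (u n)%:E < +oo)%E -> law `<< lebesgue_measure.
  move=> Soo.
  have Sfin : (\sum_(0 <= n <oo) (u n)%:E)%E \is a fin_num.
    by rewrite ge0_fin_numE// nneseries_ge0.
  pose S := fine (\sum_(0 <= n <oo) (u n)%:E)%E.
  apply: (G2_law_dominated _ xi_indep p0_ge0 p1_ge0 xi_p0 xi_p1 (expR S)) => n.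
  apply: (@le_trans _ _ (\prod_(i < n) expR (u i))).
    apply: ler_prod => i _; rewrite chi2_term_le// andbT.
    by rewrite addr_ge0// divr_ge0 ?sqr_ge0 ?subr_ge0// ltW.
  rewrite -expR_sum ler_expR -lee_fin /S fineK// -sumEFin.
  rewrite -(big_mkord xpredT (fun i => (u i)%:E)).
  exact: nneseries_lim_ge.
have singP : ~ (\sum_(0 <= n <oo) (u n)%:E < +oo)%E ->
    exists N : set R, [/\ measurable N, lebesgue_measure N = 0%E & law (~` N) = 0%E].
  move=> Soo; apply: (G2_law_singular _ xi_indep p0_ge0 p1_ge0 xi_p0 xi_p1) => e e0.
  (* The affinity is at most [expR (- sum / K)], and [expR (- t) <= t^-1]; hence
     partial sums beyond [K / e] suffice. *)
  pose K := 4 * (g0^-1 ^+ 2 + (1 - g0)^-1 ^+ 2).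
  have K0 : 0 < K.
    by rewrite mulr_gt0// addr_gt0// exprn_gt0// invr_gt0// subr_gt0.
  have [n hn] : exists n, K / e < \sum_(i < n) u i.
    apply: contrapT => /forallNP h; apply: Soo.
    apply: (@le_lt_trans _ _ (K / e)%:E); last exact: ltry.
    apply: lime_le; first exact: is_cvg_nneseries.
    apply: nearW => n; rewrite big_mkord sumEFin lee_fin leNgt.
    exact/negP/h.
  exists n; apply: (@le_trans _ _ (\prod_(i < n) expR (- (u i / K)))).
    apply: ler_prod => i _; rewrite affinity_le// andbT.
    by rewrite addr_ge0// sqrtr_ge0.
  rewrite -expR_sum sumrN expRN -mulr_suml.
  rewrite -[leRHS]invrK lef_pV2 ?posrE ?expR_gt0 ?invr_gt0//.
  apply: le_trans (expR_ge1Dx _); rewrite -[leLHS]add0r lerD//.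
  by rewrite ler_pdivlMr// mulrC ltW.
split.
  have [Soo|Soo] := pselect (\sum_(0 <= n <oo) (u n)%:E < +oo)%E.
    by left; exact: acP.
  right; split; last exact: singP.
  move=> x; exact: (G2_law_atomless _ xi_indep p0_ge0 p1_ge0 xi_p0 xi_p1 x M_eq0).
split=> // ac; apply: contrapT => /singP[N [mN N0 lawN]].
have lN : law N = 0%E by move/null_content_dominatesP : ac; apply.
have mG (A : set R) : measurable A -> measurable (G2_rv xi_ g0_bounds @^-1` A).
  by move=> mA; exact: measurable_funPTI.
have : P setT = 0%E.
  rewrite -(setUv (G2_rv xi_ g0_bounds @^-1` N)) measureU ?setICr//.
  - rewrite preimage_setC [X in (X + _)%E](_ : _ = 0%E) ?add0e; last exact: lN.
    exact: lawN.
  - exact: mG.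
  - by apply: measurableC; exact: mG.
by rewrite probability_setT => /eqP; rewrite onee_eq0.
Qed.
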